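(* For every integer $k \ge 1$ there exists a graph that is fan-planar but not $k$-planar.
   Context: All graphs are finite and simple (no loops, no multiple edges). A drawing of a graph maps each vertex to a distinct point of the plane and each edge to a simple Jordan arc joining the points of its end-vertices (as usual, arcs do not pass through other vertices). Only simple drawings are considered: the arcs of any two distinct edges have at most one point in common, which is either a common end-vertex or a common interior point where the two arcs properly cross. Two edges are independent if they share no end-vertex. A fan-planar drawing is a (simple) drawing such that: (a) no edge is crossed by two independent edges; (b) there are no two adjacent edges $(u,v)$, $(u,w)$ that both cross the same edge $e$ from different sides of $e$ while moving from $u$ to $v$ and from $u$ to $w$, respectively. A fan-planar graph is a graph that admits a fan-planar drawing. A $k$-planar drawing is a drawing in which each edge is crossed at most $k$ times, and a $k$-planar graph is a graph that admits a $k$-planar drawing. *)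

(* Defs.v *)
From mathcomp Require Import all_boot all_order all_algebra.
From mathcomp Require Import all_classical all_reals all_analysis.

Set Implicit Arguments.
Unset Strict Implicit.
Unset Printing Implicit Defensive.

Import Order.TTheory GRing.Theory Num.Theory.
Import numFieldNormedType.Exports.

Local Open Scope classical_set_scope.
Local Open Scope ring_scope.

Record sgraph := SGraph {
  vertex :> finType;
  adj : rel vertex;
  adj_sym : symmetric adj;
  adj_irrefl : irreflexive adj }.

(* An edge is the set of its two end-vertices. *)
Definition edge_set (G : sgraph) : {set {set G}} :=
  [set [set z.1; z.2]%SET | z in [set z : G * G | adj z.1 z.2]%SET]%SET.

Definition independent (G : sgraph) (e f : {set G}) : bool :=
  (e :&: f == finset.set0)%SET.

(* The arc of an edge uv is given by a parametrization for each direction of  *)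
(* travel, [arc u v] from u to v and its reverse [arc v u]; only the values   *)
(* on adjacent pairs and on parameters in [0, 1] are meaningful.              *)
Record drawing (R : realType) (G : sgraph) := Drawing {
  pos : G -> R * R;
  arc : G -> G -> R -> R * R;
  pos_inj : injective pos;
  arc_continuous : forall u v, adj u v -> {within `[0, 1], continuous (arc u v)};
  arc_inj : forall u v, adj u v -> {in `[0, 1] &, injective (arc u v)};
  arc_source : forall u v, adj u v -> arc u v 0 = pos u;
  arc_target : forall u v, adj u v -> arc u v 1 = pos v;
  arc_reverse : forall u v (t : R), adj u v -> t \in `[0, 1] ->
    arc v u t = arc u v (1 - t);
  arc_avoids_vertices : forall u v w (t : R), adj u v -> t \in `[0, 1] ->
    arc u v t = pos w -> w = u \/ w = v }.

Definition curve (R : realType) (G : sgraph) (D : drawing R G) (e : {set G}) :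
    set (R * R) :=
  [set p | exists u v, [/\ adj u v, e = [set u; v]%SET &
    exists2 t, t \in `[0, 1] & p = arc D u v t]].

Definition open_curve (R : realType) (G : sgraph) (D : drawing R G)
    (e : {set G}) : set (R * R) :=
  [set p | curve D e p /\ forall u, u \in e -> p <> pos D u].

Definition homeomorphism_on (S T : topologicalType) (U : set S) (W : set T)
    (phi : S -> T) : Prop :=
  exists psi : T -> S,
    [/\ {within U, continuous phi}, {within W, continuous psi},
        forall p, U p -> W (phi p) /\ psi (phi p) = p &
        forall q, W q -> U (psi q) /\ phi (psi q) = q].

Definition open_box (R : realType) (a b c d : R) : set (R * R) :=
  [set p | a < p.1 < b /\ c < p.2 < d].

(* Near p, the sets A and B look like the two coordinate axes near the origin. *)
Definition proper_crossing_at (R : realType) (A B : set (R * R)) (p : R * R) :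
    Prop :=
  exists (U : set (R * R)) (phi : R * R -> R * R),
    [/\ open U /\ U p,
        homeomorphism_on U (open_box (-1) 1 (-1) 1) phi,
        phi p = (0, 0),
        forall q, U q -> (A q <-> (phi q).2 = 0) &
        forall q, U q -> (B q <-> (phi q).1 = 0)].

Definition crossing_point (R : realType) (G : sgraph) (D : drawing R G)
    (e f : {set G}) (p : R * R) : Prop :=
  [/\ open_curve D e p, open_curve D f p &
      proper_crossing_at (curve D e) (curve D f) p].

Definition crosses (R : realType) (G : sgraph) (D : drawing R G)
    (e f : {set G}) : Prop :=
  e != f /\ exists p, crossing_point D e f p.

Definition simple_drawing (R : realType) (G : sgraph) (D : drawing R G) : Prop :=
  forall e f, e \in edge_set G -> f \in edge_set G -> e != f ->
    (forall p q, curve D e p -> curve D f p -> curve D e q -> curve D f q ->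
       p = q) /\
    (forall p, curve D e p -> curve D f p ->
       (exists2 u, u \in (e :&: f)%SET & p = pos D u) \/
       crossing_point D e f p).

(* A coordinate system on an open neighbourhood U of the relative interior of *)
(* the arc of xy that turns it into the segment ]0, 1[ x {0} of the strip     *)
(* ]0, 1[ x ]-1, 1[; the two sides of the arc are the parts of U with         *)
(* positive and with negative second coordinate. Such coordinates exist for   *)
(* every arc by the Jordan-Schoenflies theorem, and any two choices determine *)
(* the same two sides near the arc, up to exchanging them.                    *)
Definition side_chart (R : realType) (G : sgraph) (D : drawing R G) (x y : G)
    (U : set (R * R)) (phi : R * R -> R * R) : Prop :=
  [/\ open U,
      homeomorphism_on U (open_box 0 1 (-1) 1) phi &
      forall t : R, 0 < t < 1 -> U (arc D x y t) /\ phi (arc D x y t) = (t, 0)].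

(* While moving from u to v and from u to w, respectively, the edges uv and   *)
(* uw reach their crossings with xy from different sides of xy.               *)
Definition cross_from_different_sides (R : realType) (G : sgraph)
    (D : drawing R G) (x y u v w : G) : Prop :=
  exists (U : set (R * R)) (phi : R * R -> R * R) (s t : R),
    [/\ side_chart D x y U phi,
        0 < s < 1 /\ 0 < t < 1,
        crossing_point D [set u; v]%SET [set x; y]%SET (arc D u v s) /\
        crossing_point D [set u; w]%SET [set x; y]%SET (arc D u w t),
        \forall r \near s^'-, 0 < (phi (arc D u v r)).2 &
        \forall r \near t^'-, (phi (arc D u w r)).2 < 0].

Definition fan_planar_drawing (R : realType) (G : sgraph) (D : drawing R G) :
    Prop :=
  [/\ simple_drawing D,
      forall e f g, e \in edge_set G -> f \in edge_set G -> g \in edge_set G ->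
        crosses D f e -> crosses D g e -> ~~ independent f g &
      forall x y u v w : G, adj x y -> adj u v -> adj u w -> v != w ->
        ~ cross_from_different_sides D x y u v w].

Definition fan_planar (R : realType) (G : sgraph) : Prop :=
  exists D : drawing R G, fan_planar_drawing D.

(* In a simple drawing two edges cross at most once, so the number of         *)
(* crossings on e is the number of edges crossing e.                          *)
Definition k_planar_drawing (R : realType) (k : nat) (G : sgraph)
    (D : drawing R G) : Prop :=
  simple_drawing D /\
  forall e, e \in edge_set G ->
    (#|[set f in edge_set G | `[< crosses D f e >]]%SET| <= k)%N.

Definition k_planar (R : realType) (k : nat) (G : sgraph) : Prop :=
  exists D : drawing R G, k_planar_drawing k D.

(* Main.v *)
Require Import Defs.
From mathcomp Require Import all_boot all_order all_algebra.
From mathcomp Require Import all_classical all_reals all_analysis.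
From mathcomp Require Import zify ring lra.

(* The graph is K_{3,h} with h = 6k + 3.                                      *)
(* It is fan-planar: put the three vertices of the small side at (-1, 0),     *)
(* (-1, -1) and (1, 0), the others at (0, 0), (0, 1), ..., (0, h - 1), and    *)
(* draw straight edges. Only edges at (-1, 0) cross edges at (-1, -1), so the *)
(* edges crossing a given edge all share a vertex, and since they are         *)
(* straight and issue from that vertex they all come from the same side.      *)
(* It is not k-planar: in a k-planar drawing each of the h vertices conflicts *)
(* with at most 3k others, so three of them are pairwise free of conflicts    *)
(* and span with the small side a K_{3,3} whose independent edges are         *)
(* disjoint. This is impossible: for disjoint arcs e and f the map            *)
(* (s, t) |-> e(s) - f(t) from the unit square to the plane avoids 0, so its  *)
(* winding number along the boundary is 0. Modulo 2 this is one linear        *)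
(* equation per pair of independent edges between the turning numbers of arcs *)
(* around vertices; the sum of these equations over all pairs is 1 = 0.       *)
(* Turning numbers are computed as parities on a fine grid, so that neither   *)
(* angles nor the Jordan curve theorem are needed.                            *)

Set Implicit Arguments.
Unset Strict Implicit.
Unset Printing Implicit Defensive.

(* [arc] must not be shadowed by the function of that name on sequences. *)
Import Defs.
Import Order.TTheory GRing.Theory Num.Theory.
Import numFieldNormedType.Exports.

Local Open Scope classical_set_scope.
Local Open Scope ring_scope.

(** The two halves are [K3_fan_planar] and [K3_not_k_planar]. The second rests on [K33_nonplanar]:
    however the nine arcs of a $K_{3,3}$ are placed, two independent ones meet. After
    discretisation, [turns_grid] (homotopy invariance modulo 2) gives one parity equation for each
    pair of independent arcs. [turns_opp] expresses all its terms by turnings of arcs around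
    vertices, and [K33_parity_obstruction] shows that the system of equations is inconsistent. For
    the first, [K3_seg_meet] finds all common points of two edges of the straight drawing and
    [segments_cross_properly] supplies the charts at crossings. [straight_same_side] reduces the
    topological notion of side to the sign of [area]. *)

(** * Turning parities of discrete closed and open paths around the origin *)

Section Turning.
Variable R : realDomainType.
Implicit Types (p q r s : R * R) (k : bool * bool).

(** Directions of angle in $[0, \pi)$; with this half-open choice exactly one of $p$ and $-p$ is
    upper when $p \ne 0$. *)
Definition upper p : bool := (0 < p.2) || ((p.2 == 0) && (0 < p.1)).

(* For a short step from p to q, whether it crosses the positive half of the  *)
(* first axis.                                                                *)
Definition turn p q : bool := (upper p (+) upper q) && (0 < p.1).

(** The four open coordinate half-planes cover the plane minus the origin. A step is short when both
    its ends lie in a common one, which takes the place of a small angle. *)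
Definition axis_half k p : bool :=
  let c := if k.1 then p.1 else p.2 in if k.2 then 0 < c else c < 0.

Lemma axis_half_exists p : p != 0 -> exists k, axis_half k p.
Proof.
case: p => x y p0; have [x0|x0|x0] := ltrgtP x 0.
- by exists (true, false).
- by exists (true, true).
have [y0|y0|y0] := ltrgtP y 0.
- by exists (false, false).
- by exists (false, true).
by move: p0; rewrite x0 y0 eqxx.
Qed.

Lemma upperN p : p != 0 -> upper (- p) = ~~ upper p.
Proof.
case: p => x y p0; rewrite /upper /= !oppr_gt0 oppr_eq0.
have [y0|y0|y0] //= := ltrgtP y 0.
have [x0|x0|x0] //= := ltrgtP x 0.
by move: p0; rewrite x0 y0 eqxx.
Qed.

(** Inside one such half-plane [turn] is the change of a function, [upper] where the first
    coordinate is positive and a constant elsewhere, so its sum along a path depends only on the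
    ends. *)
Lemma turn_quadrilateral k p q r s :
    axis_half k p -> axis_half k q -> axis_half k r -> axis_half k s ->
  turn p q (+) turn q r = turn p s (+) turn s r.
Proof.
rewrite /turn /axis_half /upper.
case: k => [[] []] /= hp hq hr hs.
- rewrite hp hq hs !andbT.
  by do 4!case: (_ || _).
- by rewrite !(lt_gtF hp, lt_gtF hq, lt_gtF hr, lt_gtF hs) !andbF.
- by rewrite hp hq hr hs.
- by rewrite !(lt_gtF hp, lt_gtF hq, lt_gtF hr, lt_gtF hs,
    lt_eqF hp, lt_eqF hq, lt_eqF hr, lt_eqF hs).
Qed.

(** Negation exchanges the two halves of the first axis, and a short step changes [upper] exactly
    when it crosses one of them. *)
Lemma turnN k p q : axis_half k p -> axis_half k q ->
  turn (- p) (- q) = turn p q (+) (upper p (+) upper q).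
Proof.
rewrite /turn.
have nz u : axis_half k u -> u != 0.
  rewrite /axis_half; apply: contraTneq => ->.
  by case: k => [[] []]; rewrite /= ltxx.
move=> hp hq; rewrite !upperN; [|exact: nz..].
move: hp hq {nz}; rewrite /axis_half /upper.
case: k => [[] []] /= hp hq; rewrite ?oppr_gt0.
- by rewrite hp (lt_gtF hp) !andbT andbF addbb.
- by rewrite hp (lt_gtF hp) andbT !andbF addbN addNb negbK.
- by rewrite hp hq.
- by rewrite !(lt_gtF hp, lt_gtF hq, lt_eqF hp, lt_eqF hq).
Qed.

Definition turns (n : nat) (g : nat -> R * R) : bool :=
  \big[addb/false]_(i < n) turn (g i) (g i.+1).

Lemma turns0 g : turns 0 g = false.
Proof. exact: big_ord0. Qed.

Lemma turnsS n g : turns n.+1 g = turns n g (+) turn (g n) (g n.+1).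
Proof. exact: big_ord_recr. Qed.

Lemma turns_opp n (g : nat -> R * R) :
    (forall i, (i < n)%N -> exists k, axis_half k (g i) && axis_half k (g i.+1)) ->
  turns n (fun i => - g i) = turns n g (+) (upper (g 0) (+) upper (g n)).
Proof.
elim: n => [|n IH] hg; first by rewrite !turns0 addbb.
rewrite !turnsS IH; last first.
  by move=> i ni; apply: hg; rewrite ltnW.
have [k /andP[h1 h2]] := hg _ (ltnSn n).
rewrite (turnN h1 h2).
by case: turns; case: turn; case: upper; case: upper; case: upper.
Qed.

(** Discrete homotopy invariance: every cell contributes 0 and inner edges cancel modulo 2, which
    leaves the boundary of the grid. *)
Lemma turns_grid m n (h : nat -> nat -> R * R) :
    (forall i j, (i < m)%N -> (j < n)%N -> exists k,
      [&& axis_half k (h i j), axis_half k (h i.+1 j),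
          axis_half k (h i j.+1) & axis_half k (h i.+1 j.+1)]) ->
  turns m (h^~ 0) (+) turns n (h m) = turns n (h 0) (+) turns m (h^~ n).
Proof.
move=> hh; elim: n hh => [|n IH] hh.
  by rewrite !turns0 addbF.
have {}IH := IH (fun i j im jn => hh i j im (ltnW jn)).
have row : forall l, (l <= m)%N -> turns l (h^~ n) (+) turn (h l n) (h l n.+1) =
    turn (h 0 n) (h 0 n.+1) (+) turns l (h^~ n.+1).
  elim=> [|l IHl] lm; first by rewrite !turns0 addbF.
  rewrite !turnsS.
  have [k /and4P[h1 h2 h3 h4]] := hh _ _ lm (ltnSn n).
  have := turn_quadrilateral h1 h2 h4 h3.
  move: (IHl (ltnW lm)).
  do 2!case: turns; case: turn; case: turn; case: turn; case: turn; by case: turn.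
rewrite !turnsS.
move: IH (row m (leqnn m)).
do 5!case: turns; case: turn; by case: turn.
Qed.

End Turning.

(** * The parity contradiction for a discretised $K_{3,3}$ *)

Section K33Parity.
Variable R : realDomainType.

(* [p a b x] and [q a b y] stand for the turning parities of the arc ab around *)
(* the vertex x of the same side as a and y of the same side as b; the right- *)
(* hand side is the contribution of the directions between end-vertices, where *)
(* reversing a direction flips the parity: this is what makes the sum odd.    *)
Lemma K33_parity_obstruction (q : 'I_3 -> 'I_3 -> 'I_3 -> bool)
    (p : 'I_3 -> 'I_3 -> 'I_3 -> bool) (U : 'I_3 -> 'I_3 -> bool)
    (UM : 'I_3 -> 'I_3 -> bool) (V : 'I_3 -> 'I_3 -> bool) :
  (forall b y, b != y -> V y b = ~~ V b y) ->
  ~ (forall a x b y, a != x -> b != y ->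
     p a b x (+) q a b y (+) (p x y a (+) q x y b) =
     U a x (+) UM a y (+) (~~ UM x b (+) V b y)).
Proof.
move=> Vanti H.
(* Adding the equations for $(b, y)$ and $(y, b)$ cancels [U] and, since [V] flips under the swap,
   leaves the constant 1 in [E]. *)
pose r a b y := q a b y (+) q a y b.
pose f a x b := p a b x (+) p x b a (+) UM a b (+) UM x b.
have E a x b y : a != x -> b != y -> r a b y (+) r x b y = ~~ (f a x b (+) f a x y).
  move=> ax bY.
  have E1 : q a b y (+) q x y b = p a b x (+) p x y a (+)
      (UM a y (+) UM x b) (+) ~~ (U a x (+) V b y).
    move: (H a x b y ax bY); move: (UM a y) (UM x b) (U a x) (V b y).
    by case: (p a b x) (p x y a) (q a b y) (q x y b) => [] [] [] [] [] [] [] [].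
  have E2 : q a y b (+) q x b y = p a y x (+) p x b a (+)
      (UM a b (+) UM x y) (+) (U a x (+) V b y).
    have yb : y != b by rewrite eq_sym.
    move: (H a x y b ax yb); rewrite (Vanti b y bY).
    move: (UM a b) (UM x y) (U a x) (V b y).
    by case: (p a y x) (p x b a) (q a y b) (q x b y) => [] [] [] [] [] [] [] [].
  rewrite /r [q x b y (+) _]addbC addbACA E1 E2 /f.
  case: (U a x (+) V b y).
    move: (UM a b) (UM x b) (UM a y) (UM x y).
    by case: (p a b x) (p x b a) (p a y x) (p x y a) => [] [] [] [] [] [] [] [].
  move: (UM a b) (UM x b) (UM a y) (UM x y).
  by case: (p a b x) (p x b a) (p a y x) (p x y a) => [] [] [] [] [] [] [] [].
pose i0 : 'I_3 := ord0; pose i1 : 'I_3 := lift ord0 ord0.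
pose i2 : 'I_3 := ord_max.
(* Over the three pairs $\{b, y\}$ each [f] term occurs twice and the constant 1 three times, so the
   boolean [g] would take three pairwise distinct values. *)
pose g a := r a i0 i1 (+) r a i1 i2 (+) r a i0 i2.
have G a x : a != x -> g a != g x.
  move=> ax; move: (E a x i0 i1 ax isT) (E a x i1 i2 ax isT) (E a x i0 i2 ax isT).
  rewrite /g; case: (f a x i0) (f a x i1) (f a x i2) => [] [] [];
  case: (r a i0 i1) (r a i1 i2) (r a i0 i2) => [] [] [];
  by case: (r x i0 i1) (r x i1 i2) (r x i0 i2) => [] [] [].
move: (G i0 i1 isT) (G i1 i2 isT) (G i0 i2 isT).
by case: (g i0) (g i1) (g i2) => [] [] [].
Qed.

(** The four sides of the grid of differences of two arcs compare one arc with an end-vertex of the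
    other, so [turns_grid] yields exactly the equations refuted above. *)
Lemma K33_grid n (P Q : 'I_3 -> R * R) (e : 'I_3 -> 'I_3 -> nat -> R * R) :
    injective P -> injective Q -> (forall a b, P a != Q b) ->
    (forall a b, e a b 0%N = P a) -> (forall a b, e a b n = Q b) ->
  ~ (forall a x b y i j, a != x -> b != y -> (i < n)%N -> (j < n)%N -> exists k,
    [&& axis_half k (e a b i - e x y j), axis_half k (e a b i.+1 - e x y j),
        axis_half k (e a b i - e x y j.+1) &
        axis_half k (e a b i.+1 - e x y j.+1)]).
Proof.
move=> Pinj Qinj PQ e0 en H.
case: n e0 en H => [|n'] e0 en H.
  by have /eqP[] := PQ ord0 ord0; rewrite -(e0 _ ord0) en.
set n := n'.+1 in en H.
apply: (@K33_parity_obstruction (fun a b y => turns n (fun i => e a b i - Q y))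
  (fun a b x => turns n (fun i => e a b i - P x))
  (fun a x => upper (P x - P a)) (fun a y => upper (Q y - P a))
  (fun b y => upper (Q y - Q b))) => [b y bY|a x b y ax bY].
  by rewrite -opprB upperN// subr_eq0 (inj_eq Qinj) eq_sym.
have := turns_grid (fun i j => H a x b y i j ax bY).
rewrite -!/n.
have -> : turns n (fun i => e a b i - e x y 0) = turns n (fun i => e a b i - P x).
  by rewrite e0.
have -> : turns n (fun i => e a b i - e x y n) = turns n (fun i => e a b i - Q y).
  by rewrite en.
(* On these two sides the differences are vertex minus arc. Negating them gives the arc seen from
   the vertex, at the cost of the two end directions. *)
have L z (c : nat) : z = e a b c -> (c == 0)%N || (c == n) ->
  turns n (fun j => e a b c - e x y j) =
  turns n (fun j => e x y j - z) (+) (upper (P x - z) (+) upper (Q y - z)).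
  move=> -> cn.
  rewrite -(e0 x y) -(en x y) -turns_opp; last first.
    move=> j jn; have axN : x != a by rewrite eq_sym.
    have bYN : y != b by rewrite eq_sym.
    case/orP: cn => /eqP ->.
      have [k /and4P[h1 h2 _ _]] := H x a y b j 0%N axN bYN jn isT.
      by exists k; rewrite h1 h2.
    have [k /and4P[_ _ h1 h2]] := H x a y b j n' axN bYN jn (ltnSn _).
    by exists k; rewrite h1 h2.
  by rewrite /turns; apply: eq_bigr => i _; rewrite !opprB.
rewrite (L (P a) 0%N)// (L (Q b) n)//; last by rewrite eqxx orbT.
have -> : upper (P x - Q b) = ~~ upper (Q b - P x).
  by rewrite -opprB upperN// subr_eq0 eq_sym.
do 4!case: turns; case: (upper (P x - P a)); case: (upper (Q b - P x));
 case: (upper (Q y - P a)); by case: (upper (Q y - Q b)).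
Qed.

End K33Parity.

(** * From continuous arcs to a fine grid *)

Section NonplanarK33.
Variable R : realType.
Implicit Types (f g : R -> R * R) (s t : R).

Definition stays_in_axis_half f g (d s t : R) : Prop :=
  exists k, forall s' t', s' \in `[0, 1] -> t' \in `[0, 1] ->
    `|s' - s| <= d -> `|t' - t| <= d -> axis_half k (f s' - g t').

Lemma axis_half_ball k (p q : R * R) : axis_half k (p - q) ->
  exists2 e : R, 0 < e & forall p' q', ball p e p' -> ball q e q' -> axis_half k (p' - q').
Proof.
case: p q => [p1 p2] [q1 q2].
case: k => [b []]; rewrite /axis_half /= => h.
  exists ((if b then p1 - q1 else p2 - q2) / 2); first by case: b h => h; lra.
  move=> [p1' p2'] [q1' q2'].
  rewrite /ball /= /prod_ball /= /ball /= !ltr_distl.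
  by case: b h => h [/andP[? ?] /andP[? ?]] [/andP[? ?] /andP[? ?]]; lra.
exists (- (if b then p1 - q1 else p2 - q2) / 2); first by case: b h => h; lra.
move=> [p1' p2'] [q1' q2'].
rewrite /ball /= /prod_ball /= /ball /= !ltr_distl.
by case: b h => h [/andP[? ?] /andP[? ?]] [/andP[? ?] /andP[? ?]]; lra.
Qed.

Lemma within_continuous_ball f s (e : R) :
    {within `[0, 1], continuous f} -> s \in `[0, 1] -> 0 < e ->
  exists2 d : R, 0 < d & forall s', s' \in `[0, 1] -> `|s' - s| < d ->
    ball (f s) e (f s').
Proof.
move=> /subspace_continuousP cf s01 e0.
have := cf s s01 => /cvg_ballP /(_ e e0) /nbhs_ballP[d /= d0 hd].
exists d => // s' s'01 s's; apply: hd => //.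
by rewrite /ball /= distrC.
Qed.

(** A Lebesgue number argument: the difference avoids 0 on the compact unit square, so one mesh
    serves all base points. *)
Lemma stays_in_axis_half_near f g :
    {within `[0, 1], continuous f} -> {within `[0, 1], continuous g} ->
    (forall s t, s \in `[0, 1] -> t \in `[0, 1] -> f s <> g t) ->
  \forall n \near \oo, forall s t, s \in `[0, 1] -> t \in `[0, 1] ->
    stays_in_axis_half f g n.+1%:R^-1 s t.
Proof.
move=> cf cg fg.
have /compact_near_coveringP K :=
  compact_setX (@segment_compact R 0 1) (@segment_compact R 0 1).
have {K} := K nat \oo (fun n z => stays_in_axis_half f g n.+1%:R^-1 z.1 z.2) _.
move=> /(_ _) K; apply: (filterS _ (K _)) => [n h s t s01 t01|].
  exact: (h (s, t)).
move=> [s t] [/= s01 t01].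
have /axis_half_exists[k] : f s - g t != 0 by apply/eqP => /subr0_eq /fg; exact.
move=> /axis_half_ball[e e0 he].
have [d1 d10 h1] := within_continuous_ball cf s01 e0.
have [d2 d20 h2] := within_continuous_ball cg t01 e0.
(* Half of [d] is spent on moving the base point and half on the distance from it. *)
pose d := Num.min d1 d2.
have d0 : 0 < d / 2 by rewrite divr_gt0// lt_min d10.
exists (ball ((s, t) : R * R) (d / 2), [set n | n.+1%:R^-1 < d / 2]) => /=.
  split; first exact: nbhsx_ballx.
  exact: (near_infty_natSinv_lt (PosNum d0)).
move=> [[s1 t1] n] [/= [/= s1s t1t] nd].
exists k => s' t' s'01 t'01 s's t't; apply: he.
  apply: h1 => //; apply: lt_le_trans (_ : d <= _); last by rewrite ge_min lexx.
  rewrite [d]splitr -(subrKA s1); apply: (le_lt_trans (ler_normD _ _)).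
  apply: ltrD; first exact: le_lt_trans s's nd.
  by rewrite distrC.
apply: h2 => //; apply: lt_le_trans (_ : d <= _); last by rewrite ge_min lexx orbT.
rewrite [d]splitr -(subrKA t1); apply: (le_lt_trans (ler_normD _ _)).
apply: ltrD; first exact: le_lt_trans t't nd.
by rewrite distrC.
Qed.

(** If all independent pairs were disjoint, a mesh common to these finitely many pairs would give
    the configuration excluded by [K33_grid]. The arcs may be non-injective. *)
Lemma K33_nonplanar (P Q : 'I_3 -> R * R) (e : 'I_3 -> 'I_3 -> R -> R * R) :
    injective P -> injective Q -> (forall a b, P a <> Q b) ->
    (forall a b, {within `[0, 1], continuous (e a b)}) ->
    (forall a b, e a b 0 = P a) -> (forall a b, e a b 1 = Q b) ->
  exists a x b y s t, [/\ a != x, b != y, s \in `[0, 1], t \in `[0, 1] &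
    e a b s = e x y t].
Proof.
move=> Pinj Qinj PQ ce e0 e1; apply: contrapT => none.
have disj a x b y : a != x -> b != y ->
    forall s t, s \in `[0, 1] -> t \in `[0, 1] -> e a b s <> e x y t.
  move=> ax bY s t s01 t01 est; apply: none.
  by exists a, x, b, y, s, t; split.
have : \forall n \near \oo, forall z : ('I_3 * 'I_3) * ('I_3 * 'I_3),
    z.1.1 != z.1.2 -> z.2.1 != z.2.2 ->
    forall s t, s \in `[0, 1] -> t \in `[0, 1] ->
    stays_in_axis_half (e z.1.1 z.2.1) (e z.1.2 z.2.2) n.+1%:R^-1 s t.
  apply: filter_forall => -[[a x] [b y]] /=.
  have [->|ax] := eqVneq a x; first by apply: filterE.
  have [->|bY] := eqVneq b y; first by apply: filterE.
  apply: (filterS _ (stays_in_axis_half_near (ce a b) (ce x y) (disj _ _ _ _ ax bY))).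
  by move=> n h _ _.
move=> [n _ /(_ n (leqnn n)) hn].
pose grid i : R := i%:R / n.+1%:R.
have grid01 i : (i <= n.+1)%N -> grid i \in `[0, 1].
  by move=> ni; rewrite in_itv /= divr_ge0//= ler_pdivrMr// mul1r ler_nat.
have gridS i : `|grid i.+1 - grid i| <= n.+1%:R^-1.
  by rewrite /grid -mulrBl -natrB// subSnn mul1r ger0_norm.
have grid0 i : `|grid i - grid i| <= n.+1%:R^-1 by rewrite subrr normr0.
apply: (@K33_grid _ n.+1 P Q (fun a b i => e a b (grid i)) Pinj Qinj).
- by move=> a b; apply/eqP.
- by move=> a b; rewrite /grid mul0r e0.
- by move=> a b; rewrite /grid divff ?e1.
move=> a x b y i j ax bY iN jN.
have [k hk] := hn ((a, x), (b, y)) ax bY _ _ (grid01 i (ltnW iN)) (grid01 j (ltnW jN)).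
by exists k; apply/and4P; split; apply: hk; rewrite ?grid01 ?grid0 ?gridS// ltnW.
Qed.

End NonplanarK33.

(** * The graph $K_{3,h}$ and its edges *)

Definition K3_adj h (u v : 'I_3 + 'I_h) : bool :=
  match u, v with
  | inl _, inr _ | inr _, inl _ => true
  | _, _ => false
  end.

Lemma K3_adj_sym h : symmetric (@K3_adj h). Proof. by do 2!case. Qed.

Lemma K3_adj_irrefl h : irreflexive (@K3_adj h). Proof. by case. Qed.

Definition K3 h : sgraph := SGraph (@K3_adj_sym h) (@K3_adj_irrefl h).

Definition K3_edge h (a : 'I_3) (i : 'I_h) : {set K3 h} :=
  [set (inl a : K3 h); (inr i : K3 h)]%SET.

Lemma K3_edge_inl h a b (i : 'I_h) : (inl b \in K3_edge a i) = (b == a).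
Proof. by rewrite !inE orbF. Qed.

Lemma K3_edge_inr h a (i j : 'I_h) : (inr j \in K3_edge a i) = (j == i).
Proof. by rewrite !inE. Qed.

Lemma K3_edge_inj h a b (i j : 'I_h) : K3_edge a i = K3_edge b j -> a = b /\ i = j.
Proof.
move=> E; split; apply/eqP.
  by rewrite -(K3_edge_inl b a j) -E K3_edge_inl.
by rewrite -(K3_edge_inr b j i) -E K3_edge_inr.
Qed.

Lemma K3_edgeI h a b (i j : 'I_h) : a != b -> i != j ->
  K3_edge a i :&: K3_edge b j = finset.set0.
Proof.
move=> ab ij; apply/setP => -[c|c]; rewrite finset.in_setI !inE /=.
  rewrite !orbF; apply/negP => /andP[/eqP[->] /eqP[E]].
  by rewrite E eqxx in ab.
by apply/negP => /andP[/eqP[->] /eqP[E]]; rewrite E eqxx in ij.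
Qed.

Lemma K3_edge_in h a (i : 'I_h) : K3_edge a i \in edge_set (K3 h).
Proof. by apply/imsetP; exists (inl a, inr i); rewrite ?inE. Qed.

Lemma K3_edgeP h (e : {set K3 h}) :
  e \in edge_set (K3 h) -> exists a i, e = K3_edge a i.
Proof.
move=> /imsetP[[[a|i] [b|j]]]; rewrite inE //= => _ ->.
  by exists a, j.
by exists b, i; rewrite /K3_edge finset.setUC.
Qed.

Lemma ord3_cases (a : 'I_3) : [|| a == 0, a == 1 | a == 2%R].
Proof. by case: a => [[|[|[|m]]] ltm]. Qed.

Lemma curve_K3_edge (R : realType) h (D : drawing R (K3 h)) a i t :
  t \in `[0, 1] -> curve D (K3_edge a i) (arc D (inl a) (inr i) t).
Proof. by move=> t01; exists (inl a), (inr i); split=> //; exists t. Qed.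

(** * $K_{3,6k+3}$ is not $k$-planar *)

Section NotKPlanar.
Variables (R : realType) (k : nat).
Let h := (6 * k + 3)%N.
Variable D : drawing R (K3 h).
Hypothesis D_planar : k_planar_drawing k D.

Let conflict (i : 'I_h) : {set 'I_h} :=
  [set j | [exists a, exists b, `[< crosses D (K3_edge b j) (K3_edge a i) >]]]%SET.

(** Each of the three edges at [i] is crossed by at most $k$ edges, and every edge has a single end
    on the large side. *)
Let card_conflict i : (#|conflict i| <= 3 * k)%N.
Proof.
pose conflict1 a := [set j | [exists b, `[< crosses D (K3_edge b j) (K3_edge a i) >]]]%SET.
have le1 a : (#|conflict1 a| <= k)%N.
  apply: leq_trans (D_planar.2 _ (K3_edge_in a i)).
  pose end_of (f : {set K3 h}) := [pick j : 'I_h | inr j \in f].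
  rewrite -(card_imset (mem (conflict1 a)) (@Some_inj _)).
  apply: leq_trans (leq_imset_card end_of _); apply: subset_leq_card.
  apply/fintype.subsetP => _ /imsetP[j + ->]; rewrite inE => /existsP[b /asboolP c].
  apply/imsetP; exists (K3_edge b j); first by rewrite inE K3_edge_in; apply/asboolP.
  rewrite /end_of; case: pickP => [l|/(_ j)]; rewrite K3_edge_inr ?eqxx//.
  by move=> /eqP ->.
apply: (@leq_trans #|conflict1 0 :|: conflict1 1 :|: conflict1 2%R|); last first.
  apply: (leq_trans (leq_card_setU _ _)); rewrite mulSn addnC leq_add ?le1//.
  by apply: (leq_trans (leq_card_setU _ _)); rewrite mul2n -addnn leq_add.
apply/fintype.subset_leq_card/fintype.subsetP => j; rewrite !inE => /existsP[a c].
by by case/or3P: (ord3_cases a) c => /eqP -> ->; rewrite ?orbT.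
Qed.

(** In a simple drawing a common point of two edges without common end-vertex is a crossing. *)
Let conflict_meet a b i j (s t : R) : a != b -> i != j ->
    s \in `[0, 1] -> t \in `[0, 1] ->
    arc D (inl a) (inr i) s = arc D (inl b) (inr j) t ->
  j \in conflict i.
Proof.
move=> ab ij s01 t01 st; rewrite inE; apply/existsP; exists a; apply/existsP.
exists b; apply/asboolP.
have neq : K3_edge b j != K3_edge a i.
  by apply/eqP => /K3_edge_inj[/eqP]; rewrite eq_sym (negbTE ab).
split=> //; exists (arc D (inl b) (inr j) t).
have [_] := D_planar.1 _ _ (K3_edge_in b j) (K3_edge_in a i) neq.
move=> /(_ _ (curve_K3_edge D b j t01)).
rewrite -{1}st => /(_ (curve_K3_edge D a i s01))[[u]|//].
by rewrite K3_edgeI 1?eq_sym// inE.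
Qed.

Let avoid (F : {set 'I_h}) : (#|F| < h)%N -> exists i, i \notin F.
Proof.
move=> Fh; apply/existsP; rewrite -negb_forall; apply: contraTN Fh => /forallP F_all.
rewrite -leqNgt -[leqLHS]card_ord -cardsT.
by apply/fintype.subset_leq_card/fintype.subsetP => i _; exact: F_all.
Qed.

Lemma K3_not_k_planar : False.
Proof.
have h0 : (0 < h)%N by rewrite /h addn_gt0 orbT.
pose i0 := Ordinal h0.
pose F i := i |: conflict i.
have cardF i : (#|F i| <= (3 * k).+1)%N.
  by rewrite (leq_trans (leq_card_setU _ _))// cards1 add1n ltnS card_conflict.
have [i1 i1F] : exists i1, i1 \notin F i0.
  by apply: avoid; apply: leq_ltn_trans (cardF i0) _; rewrite /h; lia.
(* The union has at most $2(3k + 1) = 6k + 2 < h$ elements; this fixes the choice of $h$. *)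
have [i2 i2F] : exists i2, i2 \notin F i0 :|: F i1.
  apply: avoid; apply: leq_ltn_trans (leq_card_setU _ _) _.
  by apply: leq_ltn_trans (leq_add (cardF i0) (cardF i1)) _; rewrite /h; lia.
move: i1F i2F; rewrite !inE !negb_or.
rewrite -/(i1 \in conflict i0) => /andP[i10 c10] /andP[/andP[i20 c20] /andP[i21 c21]].
pose w (b : 'I_3) := tnth [tuple i0; i1; i2] b.
(* The greedy choice only keeps a later vertex out of the conflicts of an earlier one; one of the
   two orders is enough below. *)
have w_free b y : b != y -> w y \notin conflict (w b) \/ w b \notin conflict (w y).
  by case/or3P: (ord3_cases b) => /eqP ->; case/or3P: (ord3_cases y) => /eqP ->;
    rewrite //= /w !(tnth_nth i0) /= !inE; auto.
have w_inj : injective w.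
  move=> b y; rewrite /w !(tnth_nth i0).
  case/or3P: (ord3_cases b) => /eqP ->; case/or3P: (ord3_cases y) => /eqP -> //=
   => /eqP; rewrite ?(negbTE i10) ?(negbTE i20) ?(negbTE i21) // eq_sym
  ?(negbTE i10) ?(negbTE i20) ?(negbTE i21) //.
have [||||||a [x [b [y [s [t [ax bY s01 t01]]]]]]] :=
  @K33_nonplanar R (fun a => pos D (inl a)) (fun b => pos D (inr (w b)))
    (fun a b => arc D (inl a) (inr (w b))).
- by move=> a b /pos_inj[].
- by move=> a b /pos_inj[] /w_inj.
- by move=> a b /pos_inj.
- by move=> a b; exact: arc_continuous.
- by move=> a b; exact: arc_source.
- by move=> a b; exact: arc_target.
have wby : w b != w y by rewrite (inj_eq w_inj).
move=> st; have [] := w_free b y bY; apply/negP; rewrite negbK.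
  exact: (conflict_meet ax wby s01 t01 st).
by apply: (@conflict_meet x a _ _ t s _ _ t01 s01 (esym st)); rewrite eq_sym.
Qed.

End NotKPlanar.

(** * Continuity of polynomial maps *)

Lemma continuous_fun_id (T : topologicalType) : continuous (fun x : T => x).
Proof. by move=> x; exact: cvg_id. Qed.

Lemma continuous_fun_cst (T S : topologicalType) (c : S) :
  continuous (fun _ : T => c).
Proof. by move=> x; exact: cvg_cst. Qed.

Section Continuity.
Variables (R : realType) (T : topologicalType).

Lemma continuous_funD (f g : T -> R) :
  continuous f -> continuous g -> continuous (fun x => f x + g x).
Proof. by move=> cf cg x; exact: cvgD (cf x) (cg x). Qed.

Lemma continuous_funN (f : T -> R) : continuous f -> continuous (fun x => - f x).
Proof. by move=> cf x; exact: cvgN (cf x). Qed.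

Lemma continuous_funM (f g : T -> R) :
  continuous f -> continuous g -> continuous (fun x => f x * g x).
Proof. by move=> cf cg x; exact: cvgM (cf x) (cg x). Qed.

Lemma continuous_fun_pair (f g : T -> R) :
  continuous f -> continuous g -> continuous (fun x => (f x, g x)).
Proof. by move=> cf cg x; exact: cvg_pair (cf x) (cg x). Qed.

Lemma continuous_fun_fst (f : T -> R * R) :
  continuous f -> continuous (fun x => (f x).1).
Proof. by move=> cf x; apply: cvg_comp (cf x) _; exact: cvg_fst. Qed.

Lemma continuous_fun_snd (f : T -> R * R) :
  continuous f -> continuous (fun x => (f x).2).
Proof. by move=> cf x; apply: cvg_comp (cf x) _; exact: cvg_snd. Qed.

End Continuity.

Ltac prove_continuous :=
  lazymatch goal with
  | |- continuous (fun _ => ?c) => exact: continuous_fun_cst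
  | |- continuous (fun x => x) => exact: continuous_fun_id
  | |- continuous fst => move=> ?; exact: cvg_fst
  | |- continuous snd => move=> ?; exact: cvg_snd
  | |- continuous (fun x => _ + _) => apply: continuous_funD; prove_continuous
  | |- continuous (fun x => - _) => apply: continuous_funN; prove_continuous
  | |- continuous (fun x => _ * _) => apply: continuous_funM; prove_continuous
  | |- continuous (fun x => (_, _)) => apply: continuous_fun_pair; prove_continuous
  | |- continuous (fun x => fst _) => apply: continuous_fun_fst; prove_continuous
  | |- continuous (fun x => snd _) => apply: continuous_fun_snd; prove_continuous
  | _ => try assumption
  end.

(** * Straight segments and their crossings *)

Section StraightSegments.
Variable R : realType.
Implicit Types (p q : R * R) (s t r : R).

Definition seg p q t : R * R :=
  ((1 - t) * p.1 + t * q.1, (1 - t) * p.2 + t * q.2).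

Lemma seg0 p q : seg p q 0 = p.
Proof. by case: p => x y; rewrite /seg /= !subr0 !mul1r !mul0r !addr0. Qed.

Lemma seg1 p q : seg p q 1 = q.
Proof. by case: q => x y; rewrite /seg /= !subrr !mul1r !mul0r !add0r. Qed.

Lemma seg_sym p q t : seg q p t = seg p q (1 - t).
Proof. by rewrite /seg; congr pair; ring. Qed.

Lemma seg_inj p q : p != q -> injective (seg p q).
Proof.
case: p q => [p1 p2] [q1 q2] pq s t [E1 E2]; apply/eqP; rewrite -subr_eq0.
apply: contra_neqT pq => st; congr pair; apply: (mulfI st); lra.
Qed.

(* Its sign is the side of the line pq on which z lies. *)
Definition area p q z : R :=
  (q.1 - p.1) * (z.2 - p.2) - (q.2 - p.2) * (z.1 - p.1).

Lemma area_seg p q z z' t :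
  area p q (seg z z' t) = (1 - t) * area p q z + t * area p q z'.
Proof. by rewrite /area /seg /=; ring. Qed.

Lemma area_on_seg p q t : area p q (seg p q t) = 0.
Proof. by rewrite /area /seg /=; ring. Qed.

Lemma seg_continuous2 (T : topologicalType) (f g : T -> R * R) (h : T -> R) :
    continuous f -> continuous g -> continuous h ->
  continuous (fun x => seg (f x) (g x) (h x)).
Proof. by move=> cf cg ch; rewrite /seg; prove_continuous. Qed.

Lemma seg_continuous p q : continuous (seg p q).
Proof.
by apply: seg_continuous2;
  [exact: continuous_fun_cst | exact: continuous_fun_cst | exact: continuous_fun_id].
Qed.

Lemma open_box_open (a b c d : R) : open (open_box a b c d).
Proof.
rewrite (_ : open_box a b c d = fst @^-1` `]a, b[ `&` snd @^-1` `]c, d[); last first.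
  by apply/seteqP; split => -[x y]; rewrite /open_box /= !in_itv.
by apply: openI; apply: open_comp (itv_open _ _) => z _;
  [exact: cvg_fst | exact: cvg_snd].
Qed.

Lemma shift_in_unit_itv s m c :
  0 < m -> m <= s -> m <= 1 - s -> -1 < c < 1 -> s + m * c \in `[0, 1].
Proof. by move=> m0 ms ms1 /andP[c1 c2]; rewrite in_itv /=; apply/andP; split; nra. Qed.

(** The chart is affine: coordinates along the directions of the two segments, centred at their
    common point. *)
Lemma segments_cross_properly (p p' q q' : R * R) s t :
    0 < s < 1 -> 0 < t < 1 -> seg p p' s = seg q q' t ->
    (p'.1 - p.1) * (q'.2 - q.2) - (p'.2 - p.2) * (q'.1 - q.1) != 0 ->
  proper_crossing_at [set seg p p' r | r in `[0, 1]] [set seg q q' r | r in `[0, 1]]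
    (seg p p' s).
Proof.
case: p p' q q' => [p1 p2] [p1' p2'] [q1 q2] [q1' q2'] /=.
set a1 := p1' - p1; set a2 := p2' - p2; set b1 := q1' - q1; set b2 := q2' - q2.
move=> /andP[s0 s1] /andP[t0 t1] st d0.
set o := seg _ _ s.
(* With this scale, parameters $s + mc$ and $t + mc$ with $|c| < 1$ stay in $[0, 1]$, so within the
   chart each segment fills its whole axis. *)
pose m := Num.min (Num.min s (1 - s)) (Num.min t (1 - t)).
have m0 : 0 < m by rewrite !lt_min !subr_gt0 s0 s1 t0 t1.
have [ms ms' mt mt'] : [/\ m <= s, m <= 1 - s, m <= t & m <= 1 - t].
  by rewrite !ge_min !lexx ?orbT.
clearbody m.
pose d := m * (a1 * b2 - a2 * b1).
have [mN0 abN0] : m != 0 /\ a1 * b2 - a2 * b1 != 0 by split; rewrite // gt_eqF.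
(* Cramer's rule for $z - o = m (w_1 a + w_2 b)$; [psi] is the inverse. *)
pose phi (z : R * R) : R * R :=
  (((z.1 - o.1) * b2 - (z.2 - o.2) * b1) / d, (a1 * (z.2 - o.2) - a2 * (z.1 - o.1)) / d).
pose psi (w : R * R) : R * R :=
  (o.1 + m * (w.1 * a1 + w.2 * b1), o.2 + m * (w.1 * a2 + w.2 * b2)).
have phiK z : psi (phi z) = z.
  by rewrite /psi /phi /d; case: z => x y /=; congr pair; field; rewrite abN0.
have psiK w : phi (psi w) = w.
  by rewrite /psi /phi /d; case: w => x y /=; congr pair; field; rewrite abN0.
have cphi : continuous phi by rewrite /phi; prove_continuous.
have cpsi : continuous psi by rewrite /psi; prove_continuous.
have phio : phi o = (0, 0) by rewrite /phi !subrr !mul0r !mulr0 !subrr !mul0r.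
exists (phi @^-1` open_box (-1) 1 (-1) 1), phi; split.
- split; last first.
    have : open_box (-1) 1 (-1) 1 (phi o) by rewrite phio /open_box /= ltrN10 ltr01.
    by [].
 
  by apply: (@open_comp _ _ phi) => [z _|]; [exact: cphi | exact: open_box_open].
- exists psi; split.
  + exact: continuous_subspaceT.
  + exact: continuous_subspaceT.
  + by move=> z.
  + by move=> w; rewrite /= psiK.
- exact: phio.
- move=> z [/andP[z1 z1'] _]; split=> [[r _ <-]|z2].
    by rewrite /phi /o /seg /= -/a1 -/a2; apply/eqP; rewrite mulf_eq0; apply/orP; left;
     apply/eqP; rewrite /a1 /a2; ring.
  exists (s + m * (phi z).1); last first.
    by rewrite -[RHS]phiK /psi z2 /seg /o /seg /= /a1 /a2; congr pair; ring.
  by apply: shift_in_unit_itv; rewrite // z1.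
- move=> z [_ /andP[z1 z1']]; split=> [[r _ <-]|z2].
    by rewrite /phi /o st /seg /=; apply/eqP; rewrite mulf_eq0; apply/orP; left;
     apply/eqP; rewrite /b1 /b2; ring.
  exists (t + m * (phi z).2); last first.
    by rewrite -[RHS]phiK /psi z2 /o st /seg /= /b1 /b2; congr pair; ring.
  by apply: shift_in_unit_itv; rewrite // z1.
Qed.

End StraightSegments.

Lemma convex_gt0 (R : realDomainType) (r a b : R) :
  0 <= r -> r <= 1 -> 0 < a -> 0 < b -> 0 < (1 - r) * a + r * b.
Proof.
rewrite le_eqVlt => /predU1P[<- _ a0 _|r0 r1 a0 b0].
  by rewrite subr0 mul1r mul0r addr0.
by rewrite ltr_wpDl ?mulr_gt0// mulr_ge0 ?subr_ge0// ltW.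
Qed.

(** * Sides of straight edges *)

Section SidesOfStraightEdges.
Variables (R : realType) (G : sgraph) (D : drawing R G).
Hypothesis straight : forall u v (t : R), adj u v ->
  arc D u v t = seg (pos D u) (pos D v) t.

Lemma straight_curveE u v : adj u v ->
  curve D [set u; v]%SET = [set seg (pos D u) (pos D v) t | t in `[0, 1]].
Proof.
move=> uv; apply/seteqP; split=> [p [u' [v' [uv' E [t t01 ->]]]]|p [t t01 <-]]; last first.
  by exists u, v; split=> //; exists t; rewrite ?straight.
rewrite straight//.
have [[-> ->]|[-> ->]] : u' = u /\ v' = v \/ u' = v /\ v' = u; first last.
- rewrite seg_sym; exists (1 - t) => //.
  by move: t01; rewrite /= !in_itv /= => /andP[? ?]; apply/andP; split; lra.
- by exists t.
have : u' \in [set u; v]%SET by rewrite E !inE eqxx.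
have : v' \in [set u; v]%SET by rewrite E !inE eqxx orbT.
have u'v' : u' != v' by apply: contraTneq uv' => ->; rewrite adj_irrefl.
rewrite !inE => /orP[]/eqP vE /orP[]/eqP uE; auto; by rewrite uE vE eqxx in u'v'.
Qed.

Lemma straight_open_curve u v p : adj u v -> open_curve D [set u; v]%SET p ->
  exists2 t : R, 0 < t < 1 & p = seg (pos D u) (pos D v) t.
Proof.
move=> uv [+ pN]; rewrite straight_curveE// => -[t + tp].
rewrite /= in_itv /= => /andP[t0 t1]; exists t => //.
rewrite !lt_neqAle t0 t1 !andbT; apply/andP; split; apply/eqP => tE.
  by apply: (pN u); rewrite ?inE ?eqxx// -tp -tE seg0.
by apply: (pN v); rewrite ?inE ?eqxx ?orbT// -tp tE seg1.
Qed.

(* The edges uv and uw leave u on the same side of the line xy, so near their *)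
(* crossings with xy they are joined by a segment which misses that line.     *)
Lemma straight_same_side x y u v w : adj x y -> adj u v -> adj u w ->
  area (pos D x) (pos D y) (pos D u) != 0 ->
  ~ cross_from_different_sides D x y u v w.
Proof.
move=> xy uv uw L0 [U [phi [s [t [[oU [psi [cphi _ UW WU]] charc] [s01 t01]
  [[_ /(straight_open_curve xy)[s' s'01 sE] _]
   [_ /(straight_open_curve xy)[t' t'01 tE] _]] pos_s neg_t]]]]].
set L := area (pos D x) (pos D y) in L0.
have Lline r : L (seg (pos D x) (pos D y) r) = 0 by rewrite /L area_on_seg.
(* [L] is affine along the edge and vanishes at parameter [r], so at [r - r'] it is $r'/r$ times its
   value at [u]. *)
have Larc z (r r' : R) : 0 < r < 1 -> adj u z ->
    (exists2 r1 : R, 0 < r1 < 1 & arc D u z r = seg (pos D x) (pos D y) r1) ->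
  r * L (arc D u z (r - r')) = r' * L (pos D u).
  move=> r01 uz [r1 _]; rewrite !straight// => E.
  have := Lline r1; rewrite -E /L !area_seg => {}E.
  move: E; set A := area _ _ (pos D u); set B := area _ _ (pos D z) => E.
  have rB : r * B = (r - 1) * A by lra.
  transitivity (r * (1 - (r - r')) * A + (r - r') * (r * B)); first by ring.
  by rewrite rB; ring.
(* For [z.1 = 0] this segment lies on the open arc $xy$, hence in [U]; by compactness it stays in
   [U] for small [z.1]. *)
pose F (z : R * R) := seg (arc D u v (s - z.1)) (arc D u w (t - z.1)) z.2.
have cF : continuous F.
  rewrite /F; apply: seg_continuous2; last by move=> ?; exact: cvg_snd.
    under [X in continuous X]eq_fun do rewrite straight//.
    by apply: seg_continuous2; prove_continuous.
  under [X in continuous X]eq_fun do rewrite straight//.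
  by apply: seg_continuous2; prove_continuous.
have F0 r : r \in `[0, 1] -> U (F (0, r)).
  move=> r01; rewrite /F /= !subr0 sE tE.
  rewrite (_ : seg _ _ r = arc D x y ((1 - r) * s' + r * t')); last first.
    by rewrite straight// /seg /=; congr pair; ring.
  apply: (charc _ _).1; move: r01; rewrite in_itv /= => /andP[r0 r1].
  case/andP: s'01 => s'0 s'1; case/andP: t'01 => t'0 t'1; rewrite convex_gt0//=.
  rewrite -subr_gt0 (_ : _ - _ = (1 - r) * (1 - s') + r * (1 - t')); last by ring.
  by rewrite convex_gt0// subr_gt0.
have /compact_near_coveringP K := @segment_compact R 0 1.
have {K} := K R (nbhs (0 : R)) (fun d r => U (F (d, r))) _.
case=> [r r01|e3 /= e30 he3].
  have : nbhs (F (0, r)) U by exact: open_nbhs_nbhs (conj oU (F0 r r01)).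
  move=> /(cF (0, r)) [[A B] /= [A0 Br] AB].
  by exists (B, A) => // -[r' d] [/= Br' Ad]; exact: (AB (d, r')).
case: pos_s => e1 /= e10 he1; case: neg_t => e2 /= e20 he2.
pose d := Num.min e1 (Num.min e2 e3) / 2.
have d0 : 0 < d by rewrite divr_gt0// !lt_min e10 e20 e30.
have [de1 de2 de3] : [/\ d < e1, d < e2 & d < e3].
  have m0 : 0 < Num.min e1 (Num.min e2 e3) by rewrite !lt_min e10 e20 e30.
  have d_lt : d < Num.min e1 (Num.min e2 e3) by rewrite /d; lra.
  by split; apply: (lt_le_trans d_lt); rewrite !ge_min lexx ?orbT.
have UF r : r \in `[0, 1] -> U (F (d, r)).
  by apply: he3; rewrite /ball_ /= sub0r normrN gtr0_norm.
(* The second chart coordinate changes sign along the segment, which therefore meets the arc $xy$.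
   Yet at both ends [L] has the sign of its value at [u], so it vanishes nowhere between. *)
have [r r01 gr0] : exists2 r, r \in `[0, 1] & (phi (F (d, r))).2 = 0.
  apply: (@IVT R (fun r => (phi (F (d, r))).2) 0 1 0 ler01).
    apply: continuous_in_subspaceT => r; rewrite inE /= => r01.
    have cphi_at : {for F (d, r), continuous phi}.
      by move: cphi; rewrite continuous_open_subspace//; apply; rewrite inE; exact: UF.
    have c_snd : (fun r' => (d, r')) @ r --> (d, r).
      apply: (@continuous_fun_pair R R (fun=> d) id); last exact: continuous_fun_id.
      exact: continuous_fun_cst.
    have c_phi := cvg_comp _ _ (cvg_comp _ _ c_snd (cF (d, r))) cphi_at.
    apply: (cvg_comp _ _ c_phi).
    exact: cvg_snd.
  rewrite /F seg0 seg1 /=.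
  have p1 : 0 < (phi (arc D u v (s - d))).2.
    apply: he1; last by rewrite ltrBlDr ltrDl.
    by rewrite /ball_ /= opprB addrC subrK gtr0_norm.
  have p2 : (phi (arc D u w (t - d))).2 < 0.
    apply: he2; last by rewrite ltrBlDr ltrDl.
    by rewrite /ball_ /= opprB addrC subrK gtr0_norm.
  by rewrite ge_min le_max (ltW p1) (ltW p2) orbT.
have [Wq phiK] := UW _ (UF r r01).
have q01 := Wq.1.
have [_ arcE] := charc _ q01.
have Ua := (charc _ q01).1.
have qE : F (d, r) = arc D x y (phi (F (d, r))).1.
  rewrite -{1}phiK -(UW _ Ua).2 arcE; congr psi.
  by rewrite [LHS]surjective_pairing gr0.
have : L (F (d, r)) = 0 by rewrite qE straight// Lline.
rewrite /F /L area_seg /= -/L.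
have /(_ d) Ls := Larc v s _ s01 uv (ex_intro2 _ _ s' s'01 sE).
have /(_ d) Lt := Larc w t _ t01 uw (ex_intro2 _ _ t' t'01 tE).
move: Ls Lt; set A := L (arc _ _ _ _); set B := L (arc _ _ _ _); set C := L (pos D u).
move=> Ls Lt E.
have /andP[s0 _] := s01; have /andP[t0 _] := t01.
have /andP[r0 r1] : 0 <= r <= 1 by move: r01; rewrite in_itv.
have : d * C * ((1 - r) * t + r * s) = 0.
  transitivity ((1 - r) * t * (d * C) + r * s * (d * C)); first by ring.
  rewrite -{1}Ls -Lt; transitivity (s * t * ((1 - r) * A + r * B)); first by ring.
  by rewrite E mulr0.
apply/eqP/mulf_neq0; last by rewrite gt_eqF// convex_gt0.
by apply: mulf_neq0 => //; rewrite gt_eqF.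
Qed.

End SidesOfStraightEdges.

(** In the chart, $(1/2, 0)$ lies on one axis and not on the other. *)
Lemma not_proper_crossing_self (R : realType) (A : set (R * R)) p :
  ~ proper_crossing_at A A p.
Proof.
move=> [U [phi [_ [psi [_ _ _ WU]] _ h1 h2]]].
have [|Uq phiq] := WU (1 / 2, 0); first by rewrite /open_box /=; lra.
have /(h1 _ Uq)/(h2 _ Uq) : (phi (psi (1 / 2, 0))).2 = 0 by rewrite phiq.
by rewrite phiq /=; lra.
Qed.

(** * The straight fan-planar drawing of $K_{3,h}$ *)

Section FanPlanarK3.
Variables (R : realType) (h : nat).
Implicit Types (a b c : 'I_3) (i j l : 'I_h) (s t : R).

Definition K3_abscissa a : R := if a == 2%R then 1 else -1.
Definition K3_height a : R := if a == 1 then -1 else 0.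

Definition K3_pos (u : K3 h) : R * R :=
  match u with
  | inl a => (K3_abscissa a, K3_height a)
  | inr i => (0, i%:R)
  end.

Let K3_abscissa_cases a : K3_abscissa a = 1 \/ K3_abscissa a = -1.
Proof. by rewrite /K3_abscissa; case: ifP; auto. Qed.

Let K3_height_cases a : K3_height a = 0 \/ K3_height a = -1.
Proof. by rewrite /K3_height; case: ifP; auto. Qed.

Lemma K3_left_inj a b :
  K3_abscissa a = K3_abscissa b -> K3_height a = K3_height b -> a = b.
Proof.
rewrite /K3_abscissa /K3_height.
by case/or3P: (ord3_cases a) => /eqP ->; case/or3P: (ord3_cases b) => /eqP -> //= E1 E2;
  exfalso; lra.
Qed.

Lemma K3_pos_inj : injective K3_pos.
Proof.
move=> [a|i] [b|j] /[dup] /(congr1 fst) /= E1 /(congr1 snd) /= E2.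
- by rewrite (K3_left_inj E1 E2).
- by exfalso; case: (K3_abscissa_cases a) => E'; lra.
- by exfalso; case: (K3_abscissa_cases b) => E'; lra.
have -> // : i = j.
by apply: val_inj; apply/eqP; rewrite -(eqr_nat R) E2.
Qed.

Let itv01P t : t \in `[0, 1] -> 0 <= t /\ t <= 1.
Proof. by rewrite in_itv /= => /andP. Qed.

Lemma K3_seg_avoids u v w t : K3_adj u v -> t \in `[0, 1] ->
  seg (K3_pos u) (K3_pos v) t = K3_pos w -> w = u \/ w = v.
Proof.
have main a i z s : s \in `[0, 1] ->
    seg (K3_pos (inl a)) (K3_pos (inr i)) s = K3_pos z -> z = inl a \/ z = inr i.
  move=> /itv01P[s0 s1]; case: z => [c|j] [E1 E2].
    have [s_0 E] : s = 0 /\ K3_abscissa a = K3_abscissa c.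
      by move: E1; case: (K3_abscissa_cases a) => ->;
        case: (K3_abscissa_cases c) => -> E1; split; lra.
    by left; rewrite (K3_left_inj E)//; move: E2; rewrite s_0 => E2; lra.
  have s_1 : s = 1 by move: E1; case: (K3_abscissa_cases a) => -> E1; lra.
  right; have -> // : i = j.
  apply: val_inj; apply/eqP; rewrite -(eqr_nat R).
  by apply/eqP; rewrite -E2 s_1; lra.
move=> uv t01; case: u v uv => [a|i] [b|j] //= _; first exact: main.
rewrite seg_sym => /main[]; auto.
by move: t01; rewrite !in_itv /= => /andP[? ?]; apply/andP; split; lra.
Qed.

Let K3_seg_continuous (u v : K3 h) : adj u v ->
  {within `[0, 1], continuous (seg (K3_pos u) (K3_pos v))}.
Proof. by move=> _; apply: continuous_subspaceT; exact: seg_continuous. Qed.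

Let K3_seg_inj (u v : K3 h) : adj u v ->
  {in `[0, 1] &, injective (seg (K3_pos u) (K3_pos v))}.
Proof.
move=> uv s t _ _; apply: seg_inj; rewrite (inj_eq K3_pos_inj).
by apply: contraTneq uv => ->; rewrite adj_irrefl.
Qed.

Definition K3_drawing : drawing R (K3 h) :=
  @Drawing R (K3 h) K3_pos (fun u v => seg (K3_pos u) (K3_pos v)) K3_pos_inj
    K3_seg_continuous K3_seg_inj (fun _ _ _ => seg0 _ _) (fun _ _ _ => seg1 _ _)
    (fun _ _ _ _ _ => seg_sym _ _ _) K3_seg_avoids.

Let straight u v t : adj u v ->
  arc K3_drawing u v t = seg (pos K3_drawing u) (pos K3_drawing v) t.
Proof. by []. Qed.

Let K3_seg a i := seg (K3_pos (inl a)) (K3_pos (inr i)).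

(** A necessary condition for a crossing; the first two clauses force $\{a, b\} = \{0, 1\}$. *)
Definition K3_transverse a b i j : Prop :=
  [/\ K3_abscissa a = K3_abscissa b, K3_height a != K3_height b & i != j].

(** At parameter $s$ an edge has abscissa $\pm(1 - s)$, so edges that meet off the second axis do so
    at equal parameters and start on the same side of it. Equating heights leaves a linear equation
    in $s$. *)
Lemma K3_seg_meet a b i j s t : s \in `[0, 1] -> t \in `[0, 1] ->
    (a, i) != (b, j) -> K3_seg a i s = K3_seg b j t ->
  s = t /\
  [\/ a = b /\ s = 0, i = j /\ s = 1 |
      [/\ K3_transverse a b i j, 0 < s < 1 &
          (1 - s) * (K3_height a - K3_height b) = s * (j%:R - i%:R)]].
Proof.
move=> /itv01P[s0 s1] /itv01P[t0 t1] neq [E1 E2].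
have [st|[s_1 [t_1 _]]] :
    (s = t /\ K3_abscissa a = K3_abscissa b) \/ (s = 1 /\ t = 1 /\ True).
  move: E1; case: (K3_abscissa_cases a) => ->; case: (K3_abscissa_cases b) => -> E1;
  by [left; split; lra | right; split; [|split]; lra].
- case: st => st ab; split=> //; rewrite -st in E2.
  have E : (1 - s) * (K3_height a - K3_height b) = s * (j%:R - i%:R) by lra.
  have ij0 : (i == j) = (j%:R - i%:R == 0 :> R).
    by rewrite subr_eq0 eqr_nat eq_sym.
  have [/eqP aE|hab] := boolP (K3_height a == K3_height b).
    have aE' := K3_left_inj ab aE.
    apply: Or31; split=> //; move: E; rewrite aE subrr mulr0 => /esym/eqP.
    rewrite mulf_eq0 -ij0 => /orP[/eqP //|/eqP ij].
    by rewrite aE' ij eqxx in neq.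
  have [/eqP ij|ij] := boolP (i == j).
    apply: Or32; split=> //; move: E; rewrite ij subrr mulr0 => /eqP.
    by rewrite mulf_eq0 !subr_eq0 (negbTE hab) orbF => /eqP ->.
  apply: Or33; split=> //.
  rewrite !lt_neqAle s0 s1 !andbT; apply/andP; split.
    apply: contra hab => /eqP s_0; move: E; rewrite -s_0 subr0 mul1r mul0r => /eqP.
    by rewrite subr_eq0.
  apply: contra ij => /eqP s_1; move: E; rewrite s_1 subrr mul1r mul0r => /esym/eqP.
  by rewrite ij0.
- split; first by rewrite s_1 t_1.
  apply: Or32; split=> //; apply: val_inj; apply/eqP; rewrite -(eqr_nat R).
  by apply/eqP; move: E2; rewrite s_1 t_1 => E2; lra.
Qed.

Let K3_curveE a i :
  curve K3_drawing (K3_edge a i) = [set K3_seg a i t | t in `[0, 1]].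
Proof. exact: (straight_curveE straight (u := inl a) (v := inr i)). Qed.

Lemma K3_seg_open a i s : 0 < s < 1 ->
  open_curve K3_drawing (K3_edge a i) (K3_seg a i s).
Proof.
move=> /andP[s0 s1]; split.
  by rewrite K3_curveE; exists s => //=; rewrite in_itv /= !ltW.
have ai : K3_pos (inl a) != K3_pos (inr i) by apply/eqP => /K3_pos_inj.
move=> u; rewrite !inE => /orP[]/eqP -> E.
  have /(seg_inj ai) : K3_seg a i s = K3_seg a i 0 by rewrite E /K3_seg seg0.
  by move=> s_0; rewrite s_0 ltxx in s0.
have /(seg_inj ai) : K3_seg a i s = K3_seg a i 1 by rewrite E /K3_seg seg1.
by move=> s_1; rewrite s_1 ltxx in s1.
Qed.

Lemma K3_open_curves_meet a b i j p : (a, i) != (b, j) ->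
    open_curve K3_drawing (K3_edge a i) p -> open_curve K3_drawing (K3_edge b j) p ->
  K3_transverse a b i j.
Proof.
move=> neq /(straight_open_curve straight (u := inl a) (v := inr i) isT)[s s01 ->].
move=> /(straight_open_curve straight (u := inl b) (v := inr j) isT)[t t01 E].
have itv (r : R) : 0 < r < 1 -> r \in `[0, 1] by move=> /andP[? ?]; rewrite in_itv /= !ltW.
have [_ []] := K3_seg_meet (itv _ s01) (itv _ t01) neq E; last by case.
  by case=> _ s_0; rewrite s_0 ltxx in s01.
by case=> _ s_1; rewrite s_1 ltxx andbF in s01.
Qed.

Let K3_edge_neq a b i j : (K3_edge a i != K3_edge b j) = ((a, i) != (b, j)).
Proof.
congr negb; apply/eqP/eqP => [/K3_edge_inj[-> ->]//|[-> ->]//].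
Qed.

Lemma K3_crosses a b i j :
  crosses K3_drawing (K3_edge a i) (K3_edge b j) -> K3_transverse a b i j.
Proof.
by move=> [+ [p [ep fp _]]]; rewrite K3_edge_neq => neq; exact: K3_open_curves_meet ep fp.
Qed.

(** This number is the coefficient of $s$ in that linear equation, which gives uniqueness of the
    crossing. Up to sign it is also the determinant of the two directions. *)
Lemma K3_transverse_neq0 a b i j s : K3_transverse a b i j ->
    (1 - s) * (K3_height a - K3_height b) = s * (j%:R - i%:R) ->
  j%:R - i%:R + (K3_height a - K3_height b) != 0.
Proof.
move=> [_ + _] E; rewrite -subr_eq0; apply: contra => /eqP F; apply/eqP.
move: E F; set x := _ - K3_height b; set y := _ - i%:R => E F.
have yE : y = - x by lra.
by move: E; rewrite yE mulrN => E; lra.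
Qed.

Lemma K3_simple : simple_drawing K3_drawing.
Proof.
move=> _ _ /K3_edgeP[a [i ->]] /K3_edgeP[b [j ->]]; rewrite K3_edge_neq => neq.
rewrite !K3_curveE; split=> [p q [s s01 <-] [t t01 /esym E] [s' s'01 <-] [t' t'01 /esym E']|].
  have [_ c] := K3_seg_meet s01 t01 neq E; have [_ c'] := K3_seg_meet s'01 t'01 neq E'.
  congr K3_seg; case: c c' => [[ab ->]|[ij ->]|[[ab hab ij] s1 F]].
  - case=> [[_ ->]//|[ij _]|[[_ + _] _ _]]; last by rewrite ab eqxx.
    by rewrite ab ij eqxx in neq.
  - case=> [[ab _]|[_ ->]//|[[_ _ +] _ _]]; last by rewrite ij eqxx.
    by rewrite ab ij eqxx in neq.
  case=> [[aE _]|[iE _]|[tr _ F']].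
  - by rewrite aE eqxx in hab.
  - by rewrite iE eqxx in ij.
  apply: (mulIf (K3_transverse_neq0 tr F)); lra.
move=> p [s s01 <-] [t t01 /esym E].
have [st c] := K3_seg_meet s01 t01 neq E; case: c => [[ab s_0]|[ij s_1]|[tr s1 F]].
- left; exists (inl a); first by rewrite finset.in_setI !K3_edge_inl ab eqxx.
  by rewrite /K3_seg s_0 seg0.
- left; exists (inr i); first by rewrite finset.in_setI !K3_edge_inr ij eqxx.
  by rewrite /K3_seg s_1 seg1.
right; split; first exact: K3_seg_open.
  by rewrite E -st; apply: K3_seg_open.
rewrite !K3_curveE; apply: (segments_cross_properly s1 s1); first by rewrite [LHS]E st.
have := K3_transverse_neq0 tr F; case: tr => ab _ _ /= nz.
rewrite -ab !sub0r.
rewrite (_ : _ - _ = - K3_abscissa a * (j%:R - i%:R + (K3_height a - K3_height b))); last by ring.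
by apply: mulf_neq0 => //; case: (K3_abscissa_cases a) => ->; rewrite ?opprK ?oppr_eq0 oner_eq0.
Qed.

Lemma area_swap (p q z : R * R) : area q p z = - area p q z.
Proof. by rewrite /area; ring. Qed.

(** The line $xy$ is not vertical, and by transversality [u] lies vertically above or below the end
    of $xy$ on its own side of the bipartition, and differs from it. *)
Lemma K3_area_neq0 x y u v : adj x y -> adj u v ->
    crosses K3_drawing [set u; v]%SET [set x; y]%SET ->
  area (K3_pos x) (K3_pos y) (K3_pos u) != 0.
Proof.
wlog [a [i [-> ->]]] : x y / exists a i, x = inl a /\ y = inr i.
  move=> main; case: x y => [a|i] [b|j] //= xy uv c.
    by apply: (main (inl a) (inr j)) => //; exists a, j.
  rewrite area_swap oppr_eq0; apply: (main (inl b) (inr i)) => //; first by exists b, i.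
  by rewrite [X in crosses _ _ X]finset.setUC.
move=> _; have N0 : - K3_abscissa a != 0.
  by case: (K3_abscissa_cases a) => ->; rewrite ?opprK ?oppr_eq0 oner_eq0.
case: u v => [b|j] [c|l] //= _; last first.
  rewrite finset.setUC => /K3_crosses[E _ ji].
  rewrite /area /= (_ : _ - _ = - K3_abscissa a * (j%:R - i%:R)); last by ring.
  by apply: mulf_neq0 => //; rewrite subr_eq0 eqr_nat.
move=> /K3_crosses[E hba _].
rewrite /area /= E (_ : _ - _ = - K3_abscissa a * (K3_height b - K3_height a)); last by ring.
by apply: mulf_neq0 => //; rewrite subr_eq0.
Qed.

Lemma K3_fan_planar : fan_planar R (K3 h).
Proof.
exists K3_drawing; split; first exact: K3_simple.
- move=> _ _ _ /K3_edgeP[a [i ->]] /K3_edgeP[b [j ->]] /K3_edgeP[c [l ->]].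
  move=> /K3_crosses[ba hba _] /K3_crosses[ca hca _].
  (* There are only two heights, and abscissa and height determine a vertex of the small side, so
     all edges crossing a given one share that vertex. *)
  have -> : c = b.
    apply: K3_left_inj; first by rewrite ca ba.
    by move: hba hca; case: (K3_height_cases a) => ->; case: (K3_height_cases b) => ->;
      case: (K3_height_cases c) => ->; rewrite ?eqxx.
  rewrite /independent; apply/eqP => /setP /(_ (inl b)).
  by rewrite finset.in_setI !K3_edge_inl eqxx inE.
move=> x y u v w xy uv uw _ c; apply: (straight_same_side straight xy uv uw _ c).
apply: K3_area_neq0 uv _ => //.
have [U [phi [s [t [_ _ [cr _] _ _]]]]] := c.
split; last by exists (arc K3_drawing u v s).
(* [crosses] also requires distinct edges; this follows because no curve crosses itself properly. *)
by apply/eqP => E; case: cr => _ _; rewrite E; exact: not_proper_crossing_self.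
Qed.

End FanPlanarK3.

Theorem theorem3 (R : realType) (k : nat) (hk : (1 <= k)%N) :
  exists G : sgraph, fan_planar R G /\ ~ k_planar R k G.
Proof.
exists (K3 (6 * k + 3)); split; first exact: K3_fan_planar.
by move=> [D]; exact: K3_not_k_planar.
Qed.
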